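(* Let $u_{\bm r}\in\mathcal{M}_{\bm r}$ with $G(u_{\bm r})\in L^2_\mu(\Omega)$. Let $\Phi(G,u_{\bm r},\Delta t)\in L^2_\mu(\Omega)$ be the increment function of a first-order one-step scheme for $\partial u/\partial t=G(u)$, i.e. $\Phi(G,u_{\bm r},\Delta t)=G(u_{\bm r})+O(\Delta t)$ as $\Delta t\to 0^+$ (for example Euler forward, $\Phi=G(u_{\bm r})$), and let $\mathcal{S}(\Delta t,u_{\bm r})$ be one step of a first-order one-step integrator for the dynamic approximation problem $\partial u_{\bm r}/\partial t=P_{u_{\bm r}}G(u_{\bm r})$, i.e. $\mathcal{S}(\Delta t,u_{\bm r})=u_{\bm r}+\Delta t\,P_{u_{\bm r}}G(u_{\bm r})+O(\Delta t^2)$ as $\Delta t\to0^+$. Then the step-truncation method and the dynamic approximation method are consistent with each other at least to first order in $\Delta t$, that is, $$\left\|\mathfrak{T}_{\bm r}\bigl(u_{\bm r}+\Delta t\,\Phi(G,u_{\bm r},\Delta t)\bigr)-\mathcal{S}(\Delta t,u_{\bm r})\right\|_{L^2_\mu(\Omega)}=O(\Delta t^2)\qquad\text{as }\Delta t\to 0^+ .$$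
   Context: Let $\Omega=\Omega_1\times\cdots\times\Omega_d\subseteq\mathbb{R}^d$ be compact (a product of intervals, or a flat torus), $\mu=\prod_{i=1}^d\mu_i$ a finite product measure on $\Omega$, and $L^2_\mu(\Omega)$ the corresponding Hilbert space. Consider the initial/boundary value problem $\partial u/\partial t=G(u)$, $u(\bm x,0)=u_0(\bm x)$, where $G$ is a (generally nonlinear) operator with values in $L^2_\mu(\Omega)$. Manifold of fixed-rank functional tensor train (FTT) tensors. Let $\bm r=(r_0,r_1,\dots,r_d)$ be a vector of positive integers with $r_0=r_d=1$. For a matrix-valued function (core) $\bm\Psi_i$ of $x_i\in\Omega_i$ of size $r_{i-1}\times r_i$ with entries in $L^2_{\mu_i}(\Omega_i)$, let $\langle\bm\Psi_i^{T}\bm\Psi_i\rangle_i=\int_{\Omega_i}\bm\Psi_i(x_i)^T\bm\Psi_i(x_i)\,d\mu_i(x_i)\in\mathbb{R}^{r_i\times r_i}$ and $\langle\bm\Psi_i\bm\Psi_i^{T}\rangle_i=\int_{\Omega_i}\bm\Psi_i(x_i)\bm\Psi_i(x_i)^T\,d\mu_i(x_i)\in\mathbb{R}^{r_{i-1}\times r_{i-1}}$. Let $V^{(i)}_{r_{i-1}\times r_i}$ be the set of such cores for which both matrices are invertible. Define $$\mathcal{M}_{\bm r}=\{u\in L^2_\mu(\Omega): u(\bm x)=\bm\Psi_1(x_1)\bm\Psi_2(x_2)\cdots\bm\Psi_d(x_d),\ \bm\Psi_i\in V^{(i)}_{r_{i-1}\times r_i},\ i=1,\dots,d\}.$$ It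 is known (and may be used) that $\mathcal{M}_{\bm r}$ is a smooth Hilbert submanifold of $L^2_\mu(\Omega)$. The tangent space at $u_{\bm r}\in\mathcal{M}_{\bm r}$ is $T_{u_{\bm r}}\mathcal{M}_{\bm r}=\{\gamma'(0):\gamma\in C^1((-\delta,\delta),\mathcal{M}_{\bm r}),\ \gamma(0)=u_{\bm r}\}$; it is a closed subspace of $L^2_\mu(\Omega)$, and $P_{u_{\bm r}}$ denotes the orthogonal projection of $L^2_\mu(\Omega)$ onto $T_{u_{\bm r}}\mathcal{M}_{\bm r}$. Truncation operator. $\mathfrak{T}_{\bm r}(u)=\arg\min_{w\in\mathcal{M}_{\bm r}}\|u-w\|_{L^2_\mu(\Omega)}$ (best approximation on $\mathcal{M}_{\bm r}$). It is known (and may be used) that every point of $\mathcal{M}_{\bm r}$ has an open neighborhood in $L^2_\mu(\Omega)$ on which $\mathfrak{T}_{\bm r}$ is well-defined (single-valued) and smooth (in the Fréchet sense). Methods. The dynamic approximation is the evolution $\partial u_{\bm r}/\partial t=P_{u_{\bm r}}G(u_{\bm r})$ on $\mathcal{M}_{\bm r}$. Given a one-step scheme $u(t_{k+1})=u(t_k)+\Delta t\,\Phi(G,u(t_k),\Delta t)$ for $\partial u/\partial t=G(u)$, the step-truncation method is $u_{\bm r}(t_{k+1})=\mathfrak{T}_{\bm r}\bigl(u_{\bm r}(t_k)+\Delta t\,\Phi(G,u_{\bm r}(t_k),\Delta t)\bigr)$. *)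

(* Defs.v *)
From HB Require Import structures.
From mathcomp Require Import all_boot all_order all_algebra.
From mathcomp Require Import all_classical all_reals all_analysis.
From mathcomp Require Import measurable_realfun ess_sup_inf hoelder.
Set Implicit Arguments. Unset Strict Implicit. Unset Printing Implicit Defensive.
Import Order.TTheory GRing.Theory Num.Theory.
Import numFieldNormedType.Exports.
Local Open Scope classical_set_scope.
Local Open Scope ring_scope.
Local Open Scope quotient_scope.

(* The library's Lspace carries no algebraic structure; it is made a normed
   module here, with operations on representatives and the Lp norm. *)
Section Lspace_normed_module.
Context d (T : measurableType d) (R : realType).
Variables (mu : {measure set T -> \bar R}) (p : \bar R) (p1 : (1 <= p)%E).
Implicit Types (f g : LfunType mu p1) (u v w : LspaceType mu p1).

Lemma eq_ae_Lnorm (f g : T -> R) : measurable_fun setT f ->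
  measurable_fun setT g -> f = g %[ae mu] ->
  ('N[mu]_p[EFin \o f] = 'N[mu]_p[EFin \o g])%E.
Proof.
move=> mf mg fg; rewrite unlock; move: p1; case: p => [r r1|_|//].
- congr (_ `^ _)%E; apply: ae_eq_integral => //.
  + apply/measurable_EFinP.
    apply: (measurableT_comp (measurable_powR _)); exact: measurableT_comp.
  + apply/measurable_EFinP.
    apply: (measurableT_comp (measurable_powR _)); exact: measurableT_comp.
  + by apply: filterS fg => x /= h _; rewrite h.
- case: ifPn => // mu0; apply: eq_ess_sup.
  by apply: filterS fg => x /= h; rewrite h.
Qed.

Definition Lfun_val f : T -> measurableTypeR R := f.

Lemma measurable_Lfun_val f : measurable_fun setT (Lfun_val f).
Proof. have mf : measurable_fun setT (f : T -> R) by []. exact: mf. Qed.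

HB.instance Definition _ f :=
  isMeasurableFun.Build _ _ _ _ (Lfun_val f) (@measurable_Lfun_val f).

Let Lfun_mfun f : {mfun T >-> measurableTypeR R} := Lfun_val f.

Let pi_ (f : {mfun T >-> measurableTypeR R}) :
  {mfun_ mu, T >-> measurableTypeR R} := \pi f.

Let pi_ae (f : {mfun T >-> measurableTypeR R}) :
  (repr (pi_ f) : T -> R) = f %[ae mu].
Proof. by have := reprK (pi_ f) => /eqP; rewrite eqmodE => /asboolP. Qed.

Let measurable_mfun (f : {mfun T >-> measurableTypeR R}) :
  measurable_fun setT (f : T -> R).
Proof. have mf : measurable_fun setT f by []. exact: mf. Qed.

Let finite_pi f : finite_norm mu p (pi_ (Lfun_mfun f)).
Proof.
rewrite /finite_norm (@eq_ae_Lnorm _ f)//; last exact: pi_ae.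
  exact: Lfunction_finite.
exact: measurable_mfun.
Qed.

HB.instance Definition _ f :=
  @isFinLebesgue.Build d T R mu p p1 (pi_ (Lfun_mfun f)) (finite_pi f).

Definition Lclass f : LspaceType mu p1 := pi_ (Lfun_mfun f).

Lemma Lspace_Lfun u : (u : T -> R) \in Lfun mu p.
Proof.
rewrite inE; apply/andP; split; rewrite inE/=; first exact: measurable_mfun.
exact: Lebesgue_finite.
Qed.

Definition Lrepr u : LfunType mu p1 := Lfun_Sub p1 (Lspace_Lfun u).

Lemma Lclass_ae f : (Lclass f : T -> R) = f %[ae mu].
Proof. exact: pi_ae. Qed.

Lemma Lspace_val_inj u v :
  u = v :> {mfun_ mu, T >-> measurableTypeR R} -> u = v.
Proof.
case: u v => [u [[uf]]] [v [[vf]]] /= uv.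
by subst v; rewrite (Prop_irrelevance uf vf).
Qed.

Lemma Lspace_aeP u v : (u : T -> R) = v %[ae mu] -> u = v.
Proof.
move=> uv; apply: Lspace_val_inj; rewrite -[LHS]reprK -[RHS]reprK.
by apply/eqP; rewrite eqmodE; apply/asboolP.
Qed.

Lemma Lclass_eqP f g : Lclass f = Lclass g <-> f = g %[ae mu].
Proof.
split=> [fg|fg].
  apply: ae_eq_trans (Lclass_ae g); rewrite -fg; apply: ae_eq_sym.
  exact: Lclass_ae.
apply: Lspace_aeP; apply: ae_eq_trans (Lclass_ae f) _.
by apply: ae_eq_trans fg _; apply: ae_eq_sym; exact: Lclass_ae.
Qed.

Lemma LreprK : cancel Lrepr Lclass.
Proof. by move=> u; apply: Lspace_aeP; exact: Lclass_ae. Qed.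

Lemma LclassK f : Lrepr (Lclass f) = f %[ae mu].
Proof. exact: Lclass_ae. Qed.

HB.instance Definition _ := gen_eqMixin (LspaceType mu p1).
HB.instance Definition _ := gen_choiceMixin (LspaceType mu p1).

Definition Lspace_add u v := Lclass (Lrepr u + Lrepr v).
Definition Lspace_opp u := Lclass (- Lrepr u).
Definition Lspace_scale (a : R) u := Lclass (a *: Lrepr u).

Lemma LclassD f g : Lclass (f + g) = Lspace_add (Lclass f) (Lclass g).
Proof.
apply/Lclass_eqP; near=> x => _ /=; congr (_ + _).
- by apply/esym; near: x; have := LclassK f; apply: filterS => x; apply.
- by apply/esym; near: x; have := LclassK g; apply: filterS => x; apply.
Unshelve. all: by end_near. Qed.

Lemma LclassN f : Lclass (- f) = Lspace_opp (Lclass f).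
Proof.
apply/Lclass_eqP; have := LclassK f; apply: filterS => x h _ /=.
by congr (- _); exact/esym/h.
Qed.

Lemma LclassZ a f : Lclass (a *: f) = Lspace_scale a (Lclass f).
Proof.
apply/Lclass_eqP; have := LclassK f; apply: filterS => x h _ /=.
by congr (a *: _); exact/esym/h.
Qed.

Lemma Lspace_addA : associative Lspace_add.
Proof.
by move=> u v w; rewrite -[u]LreprK -[v]LreprK -[w]LreprK -!LclassD addrA.
Qed.

Lemma Lspace_addC : commutative Lspace_add.
Proof. by move=> u v; rewrite /Lspace_add addrC. Qed.

Lemma Lspace_add0 : left_id (Lclass 0) Lspace_add.
Proof. by move=> u; rewrite -[u]LreprK -LclassD add0r. Qed.

Lemma Lspace_addN : left_inverse (Lclass 0) Lspace_opp Lspace_add.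
Proof. by move=> u; rewrite -[u]LreprK -LclassN -LclassD addNr. Qed.

HB.instance Definition _ := GRing.isZmodule.Build (LspaceType mu p1)
  Lspace_addA Lspace_addC Lspace_add0 Lspace_addN.

Lemma Lspace_scaleA a b u :
  Lspace_scale a (Lspace_scale b u) = Lspace_scale (a * b) u.
Proof. by rewrite -[u]LreprK -!LclassZ scalerA. Qed.

Lemma Lspace_scale1 : left_id 1 Lspace_scale.
Proof. by move=> u; rewrite -[u]LreprK -LclassZ scale1r. Qed.

Lemma Lspace_scaleDr : right_distributive Lspace_scale +%R.
Proof.
move=> a u v; rewrite -[u]LreprK -[v]LreprK.
have DE f g : Lclass f + Lclass g = Lclass (f + g) by rewrite LclassD.
by rewrite DE -!LclassZ DE scalerDr.
Qed.

Lemma Lspace_scaleDl u : {morph Lspace_scale^~ u : a b / a + b}.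
Proof.
move=> a b; rewrite -[u]LreprK -!LclassZ scalerDl; exact: LclassD.
Qed.

HB.instance Definition _ := GRing.Zmodule_isLmodule.Build R (LspaceType mu p1)
  Lspace_scaleA Lspace_scale1 Lspace_scaleDr Lspace_scaleDl.

Definition Lspace_norm u : R := fine 'N[mu]_p[EFin \o (u : T -> R)]%E.

Let Lnorm_class f : Lspace_norm (Lclass f) = fine 'N[mu]_p[EFin \o f]%E.
Proof.
congr fine; apply: eq_ae_Lnorm => //; last exact: Lclass_ae.
exact: measurable_mfun.
Qed.

Lemma Lspace_normD u v : Lspace_norm (u + v) <= Lspace_norm u + Lspace_norm v.
Proof.
rewrite -[u]LreprK -[v]LreprK -[X in Lspace_norm X]LclassD !Lnorm_class.
exact: ler_LnormD.
Qed.

Lemma Lspace_normZ a u : Lspace_norm (a *: u) = `|a| * Lspace_norm u.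
Proof.
rewrite -[u]LreprK -[X in Lspace_norm X]LclassZ !Lnorm_class.
by rewrite -[RHS]/(fine `|a|%:E * _) -fineM// ?LnormZ// -finite_norm_fine.
Qed.

Lemma Lspace_norm_eq0 u : Lspace_norm u = 0 -> u = 0.
Proof.
rewrite -[u]LreprK Lnorm_class => /fine_Lnormr_eq0 u0.
exact/Lclass_eqP.
Qed.

HB.instance Definition _ := Lmodule_isNormed.Build R (LspaceType mu p1)
  Lspace_normD Lspace_normZ Lspace_norm_eq0.

End Lspace_normed_module.

Definition L2_inner d (T : measurableType d) (R : realType)
    (mu : {measure set T -> \bar R}) (u v : LspaceType2 mu) : R :=
  Rintegral mu setT (fun x => u x * v x).

Definition is_orthogonal_projection d (T : measurableType d) (R : realType)
    (mu : {measure set T -> \bar R}) (E : set (LspaceType2 mu))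
    (P : LspaceType2 mu -> LspaceType2 mu) : Prop :=
  forall g, E (P g) /\ forall v, E v -> L2_inner (g - P g) v = 0.

Section calculus.
Context (R : realType) (V W : normedModType R).

(* gamma is total; only its restriction to ]-delta, delta[ matters. *)
Definition tangent_space (M : set V) (u : V) : set V :=
  [set v | exists (delta : R) (gamma : R -> V), [/\ 0 < delta,
    forall t, `|t| < delta -> [/\ M (gamma t), derivable gamma t 1 &
      {for t, continuous (derive1 gamma)}],
    gamma 0 = u & derive1 gamma 0 = v]].

Definition best_approximation (M : set V) (u : V) : set V :=
  [set w | M w /\ forall z, M z -> `|u - w| <= `|u - z|].

(* Arbitrary (total) where there is no best approximation or several. *)
Definition truncation (M : set V) (u : V) : V :=
  xget 0 (best_approximation M u).

Definition tuple_set k (v : k.-tuple V) (i : 'I_k) (x : V) : k.-tuple V :=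
  [tuple if j == i then x else tnth v j | j < k].

Definition bounded_multilinear k (m : k.-tuple V -> W) : Prop :=
  (forall (v : k.-tuple V) (i : 'I_k) (a : R) (x y : V),
     m (tuple_set v i (a *: x + y)) =
     a *: m (tuple_set v i x) + m (tuple_set v i y)) /\
  exists C : R, forall v, `|m v| <= C * \prod_(j < k) `|tnth v j|.

(* D k x is the k-th Frechet derivative of f at x. The nested operator spaces
   L(V, L(V, ...)) are uncurried to bounded k-linear maps with the norm
   sup |m v| / \prod_j |v_j|, so the bound uniform in v says that D k is
   Frechet differentiable in this norm, with derivative D k.+1. *)
Definition frechet_smooth (U : set V) (f : V -> W) : Prop :=
  exists D : forall k, V -> k.-tuple V -> W, forall x, U x ->
    D 0%N x [tuple] = f x /\
    forall k, bounded_multilinear (D k x) /\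
      forall e : R, 0 < e -> \forall h \near (0 : V), forall v : k.-tuple V,
        `|D k (x + h) v - D k x v - D k.+1 x [tuple of h :: v]|
          <= e * `|h| * \prod_(j < k) `|tnth v j|.

End calculus.

(* Around every point of M, the truncation is single-valued and smooth. *)
Definition smooth_truncation (R : realType) (V : normedModType R)
    (M : set V) : Prop :=
  forall w, M w -> exists U : set V, [/\ open U, U w,
    forall u, U u -> exists! z, best_approximation M u z &
    frechet_smooth U (truncation M)].

Section functional_tensor_train.
Context (R : realType).

(* A finite measure on the compact interval [a, b] is represented by a measure
   on R carried by it. The circle R / (b - a)Z, a factor of a flat torus, is cut
   open to [a, b[: its measures are those that moreover do not charge b. *)
Definition is_carried_by (nu : {finite_measure set R -> \bar R}) (a b : R) :
    Prop :=
  nu (~` `[a, b]) = 0%E.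

(* On finite measures this determines mu, by uniqueness of extensions from
   the pi-system of measurable boxes. *)
Definition is_product_measure (d : nat)
    (mu_ : 'I_d -> {finite_measure set R -> \bar R})
    (mu : {finite_measure set (d.-tuple R) -> \bar R}) : Prop :=
  forall A : 'I_d -> set R, (forall i, measurable (A i)) ->
    mu [set x | forall i, A i (tnth x i)] = (\prod_(i < d) mu_ i (A i))%E.

Definition is_full_rank_core (nu : {finite_measure set R -> \bar R})
    (m n : nat) (Psi : R -> 'M[R]_(m, n)) : Prop :=
  [/\ forall i j, (fun t => Psi t i j) \in Lfun nu 2%:E,
      (\matrix_(i, j) Rintegral nu setT
         (fun t => ((Psi t)^T *m Psi t) i j)) \in unitmx &
      (\matrix_(i, j) Rintegral nu setT
         (fun t => (Psi t *m (Psi t)^T) i j)) \in unitmx].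

(* Variables and cores are counted from 0: Psi i is a function of x i. *)
Fixpoint tt_product (r : nat -> nat)
    (Psi : forall i, R -> 'M[R]_(r i, r i.+1)) (x : nat -> R) (n : nat) :
    'M[R]_(r 0%N, r n) :=
  if n is n'.+1 then tt_product Psi x n' *m Psi n' (x n') else 1%:M.

(* With r 0 = r d = 1 the product is a 1 x 1 matrix, and being const_mx (u x)
   means that its entry is u x. Only r 0, ..., r d and the cores of index < d
   play a role. *)
Definition ftt_manifold (d : nat)
    (mu_ : 'I_d -> {finite_measure set R -> \bar R})
    (mu : {finite_measure set (d.-tuple R) -> \bar R}) (r : nat -> nat) :
    set (LspaceType2 mu) :=
  [set u | exists Psi : forall i, R -> 'M[R]_(r i, r i.+1),
    (forall i : 'I_d, is_full_rank_core (mu_ i) (Psi i)) /\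
    {ae mu, forall x : d.-tuple R, tt_product Psi (nth 0 x) d = const_mx (u x)}].

End functional_tensor_train.

Arguments ftt_manifold {R d} mu_ mu r.

(* Main.v *)
(* Only two features of the manifold M matter: near its points the truncation T
   (the nearest-point map) is single-valued and smooth, and it fixes M.
   At u in M the derivative of T is the orthogonal projection on the tangent
   space. Its range is tangent, because t |-> T (u + t g) is a curve in M; it
   fixes tangent vectors, because T (gamma t) = gamma t along curves in M; and
   it kills normal vectors n: u is itself a competitor for the approximation of
   u + s n, so with w the image of n one gets |n - w| <= |n|, and n is
   orthogonal to the tangent vector w.
   A second-order Taylor bound for T then compares T (u + dt Phi) with
   u + dt P (G u) up to O(dt^2). *)
Require Import Defs.
From HB Require Import structures.
From mathcomp Require Import all_boot all_order all_algebra.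
From mathcomp Require Import all_classical all_reals all_analysis.
From mathcomp Require Import measurable_realfun ess_sup_inf hoelder.
From mathcomp Require Import ring lra.
Import Order.TTheory GRing.Theory Num.Theory.
Import numFieldNormedType.Exports.
Local Open Scope classical_set_scope.
Local Open Scope ring_scope.

Set Implicit Arguments.
Unset Strict Implicit.

(** * Inner products inducing the norm, and the case of square-integrable functions *)

(** The interface through which the geometry of [LspaceType2 mu] enters. Linearity in the second
    argument follows from symmetry, definiteness from the tie to the norm. *)
Definition is_inner_product (R : realType) (V : normedModType R)
    (ip : V -> V -> R) : Prop :=
  [/\ forall w a u v, ip (a *: u + v) w = a * ip u w + ip v w,
      forall u v, ip u v = ip v u & forall u, ip u u = `|u| ^+ 2].

Section L2_inner_product.
Context d (T : measurableType d) (R : realType).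
Context (mu : {measure set T -> \bar R}).
Implicit Types u v w : LspaceType2 mu.

Lemma L2_mul_integrable u v :
  mu.-integrable setT (EFin \o (fun x => u x * v x)).
Proof.
by apply/Lfun1_integrable; apply: Lfun2_mul_Lfun1; exact: Lspace_Lfun.
Qed.

Lemma Rintegral_ae_eq (f g : T -> R) :
  measurable_fun setT f -> measurable_fun setT g -> f = g %[ae mu] ->
  Rintegral mu setT f = Rintegral mu setT g.
Proof.
move=> mf mg fg; congr fine; apply: ae_eq_integral => //.
- exact/measurable_EFinP.
- exact/measurable_EFinP.
- by apply: filterS fg => x h xT /=; congr EFin; exact: h.
Qed.

Lemma measurable_L2 u : measurable_fun setT (u : T -> R).
Proof.
by have := Lspace_Lfun u; rewrite inE => /andP[]; rewrite inE.
Qed.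

(** The representative of [a *: u + v] is the pointwise combination only almost everywhere, so the
    integrands are compared by [Rintegral_ae_eq]. *)
Lemma L2_inner_linear w a u v :
  L2_inner (a *: u + v) w = a * L2_inner u w + L2_inner v w.
Proof.
have ew : ((a *: u + v : LspaceType2 mu) : T -> R) =
    (fun x => a * u x + v x) %[ae mu].
  have := Lclass_ae (a *: Lrepr u + Lrepr v).
  by rewrite LclassD LclassZ !LreprK.
rewrite /L2_inner -RintegralZl//; last exact: L2_mul_integrable.
rewrite -RintegralD//; last 2 first.
- have -> : EFin \o (fun x => a * (u x * w x)) =
      (fun x => a%:E * (EFin \o (fun x => (u x * w x)%R)) x)%E by [].
  by apply: integrableZl => //; exact: L2_mul_integrable.
- exact: L2_mul_integrable.
apply: Rintegral_ae_eq.
- by apply: measurable_funM; exact: measurable_L2.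
- by apply: measurable_funD; repeat apply: measurable_funM => //;
    exact: measurable_L2.
- by apply: filterS ew => x h xT; rewrite h// mulrDl mulrA.
Qed.

Lemma L2_innerP : is_inner_product (@L2_inner d T R mu).
Proof.
split.
- exact: L2_inner_linear.
- by move=> u v; apply: eq_Rintegral => x _; rewrite mulrC.
(* Finiteness of the norm is what allows [fine] to be exchanged with the square. *)
- move=> u; have uN : ('N[mu]_2[EFin \o (u : T -> R)] < +oo)%E.
    by have := Lspace_Lfun u; rewrite inE => /andP[_]; rewrite inE.
  have := @powR_Lnorm d T R mu (EFin \o (u : T -> R)) 2 _.
  rewrite -[`|u|]/(fine _) -(@fineK _ ('N[mu]_2[_])%E); last first.
    by rewrite ge0_fin_numE// Lnorm_ge0.
  rewrite poweR_EFin powR_mulrn ?fine_ge0 ?Lnorm_ge0// => /(_ _)/(congr1 fine).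
  rewrite /= => ->; last by rewrite pnatr_eq0.
  congr fine; apply: eq_integral => x _ /=.
  by rewrite powR_mulrn// -normrX ger0_norm ?sqr_ge0.
Qed.
End L2_inner_product.

(** * Derivatives of curves, Cauchy-Schwarz and the mean value inequality *)

(** With the division by [h] cleared, [h = 0] needs no exclusion and the bound combines with Fréchet
    estimates by the triangle inequality. *)
Lemma is_derive1P (R : realType) (W : normedModType R) (g : R -> W) (t : R) dg :
  is_derive t 1 g dg <-> forall e, 0 < e ->
    \forall h \near (0 : R), `|g (t + h) - g t - h *: dg| <= e * `|h|.
Proof.
split.
- move=> [dg1 <-] e e0.
  have /cvgrPdist_le/(_ e e0) : h^-1 *: ((g \o shift t) (h *: 1) - g t)
      @[h --> 0^'] --> 'D_1 g t by exact: dg1.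
  rewrite near_withinE; apply: filterS => h.
  have [->|h0 /(_ isT)] := eqVneq h 0.
    by move=> _; rewrite addr0 subrr scale0r subrr !normr0 mulr0.
  rewrite distrC /= [h%:A]mulr1 (addrC h) => H.
  have h0' : 0 < `|h| by rewrite normr_gt0.
  move: H; rewrite -(ler_pM2l h0') -normrZ scalerBr scalerA divff// scale1r.
  by rewrite [leRHS]mulrC.
- move=> H.
  suff D : h^-1 *: ((g \o shift t) (h *: 1) - g t) @[h --> 0^'] --> dg.
    by split; [apply/cvg_ex; exists dg|exact/cvg_lim].
  apply/cvgrPdist_le => e e0; rewrite near_withinE.
  apply: filterS (H e e0) => h K h0; rewrite distrC /= [h%:A]mulr1 (addrC h).
  have h0' : 0 < `|h| by rewrite normr_gt0.
  rewrite -(ler_pM2l h0') -normrZ scalerBr scalerA divff// scale1r.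
  by rewrite [leRHS]mulrC.
Qed.

Section inner_calculus.
Context (R : realType) (V : normedModType R) (ip : V -> V -> R).
Context (ipP : is_inner_product ip).

Lemma ip_linear w a u v : ip (a *: u + v) w = a * ip u w + ip v w.
Proof. by case: ipP. Qed.

Lemma ipC u v : ip u v = ip v u.
Proof. by case: ipP. Qed.

Lemma ip_norm u : ip u u = `|u| ^+ 2.
Proof. by case: ipP. Qed.

Lemma ip0l w : ip 0 w = 0.
Proof. by have := ip_linear w 1 0 0; rewrite scaler0 addr0; lra. Qed.

Lemma ipDl u v w : ip (u + v) w = ip u w + ip v w.
Proof. by rewrite -[u]scale1r ip_linear mul1r scale1r. Qed.

Lemma ipZl a u w : ip (a *: u) w = a * ip u w.
Proof. by rewrite -[a *: u]addr0 ip_linear ip0l addr0. Qed.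

Lemma ipBl u v w : ip (u - v) w = ip u w - ip v w.
Proof. by rewrite ipDl -scaleN1r ipZl mulN1r. Qed.

Lemma normB_sqr u v : `|u - v| ^+ 2 = `|u| ^+ 2 - 2 * ip u v + `|v| ^+ 2.
Proof.
rewrite -!ip_norm ipBl (ipC u (_ - _)) (ipC v (_ - _)) !ipBl (ipC v u).
by ring.
Qed.

Lemma Cauchy_Schwarz u v : `|ip u v| <= `|u| * `|v|.
Proof.
rewrite -ler_sqr ?nnegrE ?mulr_ge0// real_normK ?num_real// exprMn.
have [->|v0] := eqVneq v 0.
  by rewrite ipC ip0l expr0n/= mulr_ge0// exprn_ge0.
have nv : 0 < `|v| ^+ 2 by rewrite exprn_gt0// normr_gt0.
set a := ip u v; set b := `|v| ^+ 2.
(* [(a / b) *: v] is the projection of [u] on the line of [v]; the squared norm of the remainder is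
   nonnegative. *)
have /= := exprn_ge0 2 (normr_ge0 (u - (a / b) *: v)).
rewrite normB_sqr ipC ipZl (ipC v u) normrZ exprMn real_normK ?num_real//.
rewrite -/a -/b.
have -> : `|u| ^+ 2 - 2 * (a / b * a) + (a / b) ^+ 2 * b =
   (`|u| ^+ 2 * b - a ^+ 2) / b by field; rewrite gt_eqF.
by rewrite pmulr_lge0 ?invr_gt0// subr_ge0.
Qed.

Lemma is_derive_ip (g : R -> V) (t : R) dg w :
  is_derive t 1 g dg -> is_derive t 1 (fun s => ip (g s) w : R^o) (ip dg w).
Proof.
move=> /is_derive1P gP; apply/is_derive1P => e e0.
(* The [+ 1] covers [w = 0]. *)
have e'0 : 0 < e / (`|w| + 1) by rewrite divr_gt0// ltr_wpDl.
apply: filterS (gP _ e'0) => h gh.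
rewrite -[h *: _]/(h * _) -ipZl -!ipBl.
apply: le_trans (Cauchy_Schwarz _ _) _.
have : `|w| <= `|w| + 1 by lra.
move=> /(ler_pM (normr_ge0 _) (normr_ge0 _) gh) /le_trans; apply.
by rewrite mulrAC divfK// gt_eqF// ltr_wpDl.
Qed.

(* The mean value theorem, applied to the component of g along g 1 - g 0. *)
Lemma mean_value_inequality (g g' : R -> V) (C : R) :
  (forall t : R, 0 <= t <= 1 -> is_derive t 1 g (g' t)) ->
  (forall t : R, 0 <= t <= 1 -> `|g' t| <= C) ->
  `|g 1 - g 0| <= C.
Proof.
move=> gg' g'C; set w := g 1 - g 0.
have [w0|w0] := eqVneq w 0.
  by rewrite w0 normr0; apply: le_trans (g'C 0 _) => //; rewrite lexx ler01.
pose phi := fun s => ip (g s) w : R^o.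
have dphi (t : R) : 0 <= t <= 1 -> is_derive t 1 phi (ip (g' t) w).
  by move=> t01; apply: is_derive_ip; exact: gg'.
have [t t01 e] : exists2 t : R, t \in `]0, 1[%R &
    phi 1 - phi 0 = ip (g' t) w * (1 - 0).
  apply: (@MVT R phi (fun t : R => ip (g' t) w)) => //.
    by move=> x /[!in_itv]/= /andP[x0 x1]; apply: dphi; rewrite !ltW.
  apply: derivable_within_continuous => x /[!in_itv]/= x01.
  exact: (@ex_derive _ _ _ _ _ _ _ (dphi x x01)).
move: e; rewrite /phi -ipBl ip_norm subr0 mulr1 => e.
have wp : 0 < `|w| by rewrite normr_gt0.
have t01' : 0 <= t <= 1 by move: t01; rewrite in_itv/= => /andP[/ltW-> /ltW->].
(* After multiplication by [|w|], the left side [|w| ^+ 2] is [ip (g' t) w], at most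
   [|g' t| * |w|]. *)
rewrite -(ler_pM2r wp) -expr2 e (le_trans (ler_norm _))//.
rewrite (le_trans (Cauchy_Schwarz _ _))// ler_wpM2r//.
exact: g'C.
Qed.
End inner_calculus.

(** * Fréchet derivatives: chain rule along curves and second-order Taylor bound *)

(** Only the first-order expansion; linearity and boundedness of [L] are stated separately where
    they are used. *)
Definition frechet_at (R : realType) (V W : normedModType R) (f : V -> W)
    (x : V) (L : V -> W) : Prop :=
  forall e : R, 0 < e -> \forall h \near (0 : V),
    `|f (x + h) - f x - L h| <= e * `|h|.

Lemma near0_shift (R : realType) (V : normedModType R) (U : set V) x :
  open U -> U x -> \forall h \near (0 : V), U (x + h).
Proof.
move=> oU Ux.
suff : nbhs x U by move=> /nbhs0P.
by rewrite nbhsE/=; exists U.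
Qed.

(** [L] is the first derivative [D 1]. Its Lipschitz bound at [x] comes from expanding [D 1] with
    tolerance 1 and bounding the term [D 2 x (h, v)] by bilinearity, whence the constant
    [|C| + 1]. *)
Lemma frechet_smooth_C11 (R : realType) (V W : normedModType R) (U : set V)
    (f : V -> W) : open U -> frechet_smooth U f ->
  exists L : V -> V -> W, forall x, U x ->
    [/\ forall a u v, L x (a *: u + v) = a *: L x u + L x v,
        exists2 C : R, 0 < C & forall v, `|L x v| <= C * `|v|,
        frechet_at f x (L x) &
        exists2 C : R, 0 < C & \forall h \near (0 : V), forall v,
          `|L (x + h) v - L x v| <= C * `|h| * `|v|].
Proof.
move=> oU [D DP]; exists (fun x v => D 1%N x [tuple v]) => x Ux.
have [D0 Dk] := DP x Ux; split.
- move=> a u v; have [[Dlin _] _] := Dk 1%N.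
  have tE (y z : V) : tuple_set [tuple z] ord0 y = [tuple y].
    by apply: eq_from_tnth => i; rewrite tnth_mktuple !(ord1 i) eqxx.
  by have := Dlin [tuple 0] ord0 a u v; rewrite !tE.
- have [[_ [C DC]] _] := Dk 1%N; exists (`|C| + 1); first by rewrite ltr_wpDl.
  move=> v; apply: le_trans (DC _) _; rewrite big_ord1 ler_wpM2r//.
  by rewrite ler_wpDr// ler_norm.
- move=> e e0; have [_ /(_ e e0)] := Dk 0%N.
  apply: filterS2 (near0_shift oU Ux) => h Uxh /(_ [tuple]).
  rewrite big_ord0 mulr1 D0 (_ : D 0%N (x + h) [tuple] = f (x + h))//.
  by have [] := DP _ Uxh.
- have [[_ [C DC]] _] := Dk 2%N; have [_ /(_ 1 ltr01) p] := Dk 1%N.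
  exists (`|C| + 1); first by rewrite ltr_wpDl.
  apply: filterS p => h Dh v.
  have := Dh [tuple v]; rewrite big_ord1 mul1r => {}Dh.
  have := DC [tuple h; v]; rewrite big_ord_recl big_ord1 => {}DC.
  rewrite -(subrK (D 2%N x [tuple h; v]) (_ - _)).
  rewrite (le_trans (ler_normD _ _))// mulrDl mulrDl mul1r addrC lerD//.
  by rewrite (le_trans DC)// -mulrA ler_wpM2r ?mulr_ge0// ler_norm.
Qed.

(** With [k] the increment of [gamma], the error is the remainder of [f] at [k] plus
    [L (k - h *: v)]; each is made at most [e / 2 * |h|]. *)
Lemma frechet_at_chain (R : realType) (V W : normedModType R) (f : V -> W)
    (L : V -> W) (C : R) (gamma : R -> V) (t : R) (v : V) :
  (forall a u v, L (a *: u + v) = a *: L u + L v) ->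
  (forall v, `|L v| <= C * `|v|) ->
  frechet_at f (gamma t) L -> is_derive t 1 gamma v ->
  is_derive t 1 (fun s : R => f (gamma s)) (L v).
Proof.
move=> Llin LC fL gammav; apply/is_derive1P => e e0.
have C0 : 0 < `|C| + 1 by rewrite ltr_wpDl.
(* [e2] is the tolerance for [gamma], chosen against the bound of [L]; [e1] is the one for [f],
   chosen against [|k| <= (|v| + e2) * |h|]. *)
pose e2 := e / 2 / (`|C| + 1).
have e20 : 0 < e2 by rewrite !divr_gt0.
have v0 : 0 < `|v| + e2 by rewrite ltr_wpDl.
pose e1 := e / 2 / (`|v| + e2).
have e10 : 0 < e1 by rewrite !divr_gt0.
have cg : (fun h : R => gamma (t + h) - gamma t) @ 0 --> (0 : V).
  have cgamma : {for t, continuous gamma}.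
    by apply/differentiable_continuous/derivable1_diffP; exact: ex_derive.
  have ct : (t + h) @[h --> (0 : R)] --> t.
    suff : (t + h) @[h --> (0 : R)] --> (t + 0 : R) by rewrite addr0.
    by apply: cvgD; [exact: cvg_cst|exact: cvg_id].
  suff : gamma (t + h) - gamma t @[h --> (0 : R)] --> gamma t - gamma t.
    by rewrite subrr.
  by apply: cvgB; [exact: cvg_comp ct cgamma|exact: cvg_cst].
have near_f : \forall h \near (0 : R),
    `|f (gamma t + (gamma (t + h) - gamma t)) - f (gamma t)
      - L (gamma (t + h) - gamma t)| <= e1 * `|gamma (t + h) - gamma t|.
  exact: cg _ (fL e1 e10).
have /is_derive1P/(_ e2 e20) near_gamma := gammav.
apply: filterS2 near_f near_gamma => h; rewrite (addrC (gamma t)) subrK.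
set k := gamma (t + h) - gamma t => fk kv.
have Lk : L k = h *: L v + L (k - h *: v).
  by rewrite -Llin (addrC (h *: v)) subrK.
have kh : `|k| <= (`|v| + e2) * `|h|.
  rewrite -(subrK (h *: v) k) (le_trans (ler_normD _ _))// normrZ.
  by rewrite mulrDl addrC mulrC lerD2l.
have -> : f (gamma (t + h)) - f (gamma t) - h *: L v =
    (f (gamma (t + h)) - f (gamma t) - L k) + L (k - h *: v).
  by rewrite Lk opprD addrA subrK.
rewrite (le_trans (ler_normD _ _))// [e]splitr mulrDl lerD//.
- rewrite (le_trans fk)//.
  apply: le_trans (ler_wpM2l (ltW e10) kh) _.
  by rewrite mulrA divfK// gt_eqF.
- rewrite (le_trans (LC _))//.
  have : C <= `|C| + 1 by rewrite ler_wpDr// ler_norm.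
  move=> /(ler_wpM2r (normr_ge0 (k - h *: v))) /le_trans; apply.
  apply: le_trans (ler_wpM2l (ltW C0) kv) _.
  by rewrite mulrA [X in X * _]mulrC divfK// gt_eqF.
Qed.

Lemma is_derive_line (R : realType) (V : normedModType R) (x g : V) (t : R) :
  is_derive t 1 (fun s : R => x + s *: g) g.
Proof.
apply/is_derive1P => e e0; apply: (@filterE _ (nbhs (0 : R))) => h.
by rewrite scalerDl addrA (addrC (x + _)) addrK subrr normr0 mulr_ge0// ltW.
Qed.

(** The mean value inequality is applied on [0, 1] to [f (x + s *: h) - s *: L x h], whose
    derivative [L (x + s *: h) h - L x h] is at most [C * |h| ^+ 2]. *)
Lemma frechet_second_order (R : realType) (V : normedModType R)
    (ip : V -> V -> R) (ipP : is_inner_product ip) (U : set V) (f : V -> V)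
    (L : V -> V -> V) (x : V) : open U -> U x ->
  (forall y, U y -> [/\ forall a u v, L y (a *: u + v) = a *: L y u + L y v,
     exists C : R, forall v, `|L y v| <= C * `|v| & frechet_at f y (L y)]) ->
  (exists2 C : R, 0 < C & \forall h \near (0 : V), forall v,
          `|L (x + h) v - L x v| <= C * `|h| * `|v|) ->
  exists2 C : R, 0 < C & \forall h \near (0 : V),
    `|f (x + h) - f x - L x h| <= C * `|h| ^+ 2.
Proof.
move=> oU Ux UL [C C0 LC]; exists C => //.
have : \forall h \near (0 : V), U (x + h) /\
    forall v, `|L (x + h) v - L x v| <= C * `|h| * `|v|.
  exact: filterI (near0_shift oU Ux) LC.
(* A ball is extracted so that the whole segment from [x] to [x + h] lies in the good
   neighbourhood. *)
move=> /nbhs_normP[e/= e0 eP]; apply/nbhs_normP; exists e => // h /=.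
rewrite sub0r normrN => he.
have sh (s : R) : 0 <= s <= 1 -> `|s *: h| <= `|h|.
  by move=> /andP[s0 s1]; rewrite normrZ ger0_norm// ler_piMl.
have Ph (s : R) : 0 <= s <= 1 ->
    U (x + s *: h) /\
    forall v, `|L (x + s *: h) v - L x v| <= C * `|s *: h| * `|v|.
  by move=> s01; apply: eP => /=; rewrite sub0r normrN (le_lt_trans (sh _ s01)).
pose g (s : R) := f (x + s *: h) - s *: L x h.
have dg (s : R) : 0 <= s <= 1 -> is_derive s 1 g (L (x + s *: h) h - L x h).
  move=> /Ph[/UL[Llin [K KL] fL] _].
  have d1 := @frechet_at_chain _ _ _ _ _ _ (fun s : R => x + s *: h) _ _
    Llin KL fL (is_derive_line _ _ _).
  have d2 := is_derive_line 0 (L x h) s.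
  have -> : g = (fun s => f (x + s *: h)) - (fun s => 0 + s *: L x h).
    by apply/funext => s'; rewrite /g !fctE add0r.
  exact: is_deriveB.
have /= := mean_value_inequality ipP dg.
rewrite /g !scale1r !scale0r addr0 subr0 addrAC; apply.
move=> s s01; have [_ /(_ h)] := Ph s s01; move=> /le_trans; apply.
by rewrite expr2 mulrA ler_wpM2r// ler_pM2l// sh.
Qed.

(** * The truncation and its derivative at a point of the manifold *)

(** Since [z] competes for its own approximation, any best approximation is at distance 0 from
    it. *)
Lemma truncation_id (R : realType) (V : normedModType R) (M : set V) (z : V) :
  M z -> truncation M z = z.
Proof.
move=> Mz; have bz : best_approximation M z z.
  by split => // y _; rewrite subrr normr0.
have [_ /(_ z Mz)] := xgetI 0 bz.
rewrite subrr normr0 normr_le0 subr_eq0 => /eqP zE.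
by rewrite /truncation -zE.
Qed.

Lemma truncation_best (R : realType) (V : normedModType R) (M : set V) (u : V) :
  (exists! z, best_approximation M u z) ->
  best_approximation M u (truncation M u).
Proof. by move=> [z [bz _]]; exact: xgetI bz. Qed.

(** Here [p] is the orthogonal projection of [g], given by its two properties: it is tangent, and
    [g - p] is normal. *)
Lemma truncation_derivative (R : realType) (V : normedModType R)
    (ip : V -> V -> R) (ipP : is_inner_product ip) (M U : set V)
    (L : V -> V -> V) (x g p : V) : open U -> U x -> M x ->
  (forall u, U u -> best_approximation M u (truncation M u)) ->
  (forall y, U y ->
    [/\ forall a u v, L y (a *: u + v) = a *: L y u + L y v,
        exists2 C : R, 0 < C & forall v, `|L y v| <= C * `|v|,
        frechet_at (truncation M) y (L y) &
        exists2 C : R, 0 < C & \forall h \near (0 : V), forall v,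
          `|L (y + h) v - L y v| <= C * `|h| * `|v|]) ->
  tangent_space M x p ->
  (forall v, tangent_space M x v -> ip (g - p) v = 0) ->
  L x g = p.
Proof.
move=> oU Ux Mx Ubest UL xp gp; set f := truncation M.
have fx : f x = x by exact: truncation_id.
have near_line (v : V) : \forall t \near (0 : R), U (x + t *: v).
  have cv : (fun t : R => t *: v) @ 0 --> (0 : V).
    by have := @scalel_continuous R V v 0; rewrite /continuous_at scale0r.
  exact: cv _ (near0_shift oU Ux).
have d_line (v : V) (t : R) : U (x + t *: v) ->
    is_derive t 1 (fun s : R => f (x + s *: v)) (L (x + t *: v) v).
  move=> /UL[Llin [C _ LC] fL _].
  exact: (@frechet_at_chain _ _ _ _ _ _ (fun s : R => x + s *: v) _ _ Llin LC fL
    (is_derive_line _ _ _)).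
have tangentL (v : V) : tangent_space M x (L x v).
  have /nbhs_normP[e/= e0 eU] := near_line v.
  have Ue (t : R) : `|t| < e -> U (x + t *: v).
    by move=> te; apply: eU => /=; rewrite sub0r normrN.
  have dE (t : R) : `|t| < e ->
      derive1 (fun s : R => f (x + s *: v)) t = L (x + t *: v) v.
    by move=> te; rewrite derive1E; apply: derive_val; exact/d_line/Ue.
  exists e, (fun s : R => f (x + s *: v)); split => //.
  + move=> t te; have Ut := Ue _ te; split.
    * by have [] := Ubest _ Ut.
    * exact: (@ex_derive _ _ _ _ _ _ _ (d_line _ _ Ut)).
    (* The derivative of the curve is continuous because [L] is Lipschitz at [x + t *: v]: it varies
       by at most [C * |s - t| * |v| ^+ 2]. The terms [|v| + 1] avoid a division by zero. *)
    * rewrite /prop_for /continuous_at dE//; apply/cvgrPdist_le => eps eps0.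
      have [_ _ _ [C C0 LC]] := UL _ Ut.
      have K0 : 0 < C * (`|v| + 1) * (`|v| + 1).
        by rewrite !mulr_gt0// ltr_wpDl.
      have ct : (fun s : R => (s - t) *: v) @ t --> (0 : V).
        suff : (fun s : R => (s - t) *: v) @ t --> ((t - t) *: v : V).
          by rewrite subrr scale0r.
        apply: cvgZl; apply: cvgB; [exact: cvg_id|exact: cvg_cst].
      have LCt : \forall s \near t, forall w,
          `|L (x + t *: v + (s - t) *: v) w - L (x + t *: v) w|
            <= C * `|(s - t) *: v| * `|w| by exact: ct _ LC.
      have small : \forall s \near t,
          `|s - t| <= eps / (C * (`|v| + 1) * (`|v| + 1)).
        have /cvgrPdist_le/(_ _ (divr_gt0 eps0 K0)) := @cvg_id _ (nbhs t).
        by apply: filterS => s; rewrite distrC.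
      have inside : \forall s \near t, `|s| < e.
        apply/nbhs_normP; exists (e - `|t|) => /=; first by rewrite subr_gt0.
        move=> s /=; rewrite distrC => st.
        by have := ler_normD (s - t) t; rewrite subrK; lra.
      apply: filterS3 LCt small inside => s /(_ v) Ls st se.
      rewrite dE// distrC; move: Ls; rewrite -addrA -scalerDl (addrC t) subrK.
      move=> /le_trans; apply.
      rewrite normrZ; move: st; rewrite ler_pdivlMr// => /(le_trans _); apply.
      have -> : C * (`|s - t| * `|v|) * `|v| = `|s - t| * (C * `|v| * `|v|).
        by ring.
      by rewrite ler_wpM2l// -!mulrA ler_pM2l// ler_pM// lerDl.
  + by rewrite scale0r addr0.
  + by rewrite dE ?normr0// scale0r addr0.
have [Llin [C C0 LC] fL _] := UL _ Ux.
(* [f (gamma t) = gamma t] near 0, so both sides have the same derivative there. *)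
have L_tangent (v : V) : tangent_space M x v -> L x v = v.
  move=> [e [gamma [e0 Mgamma gamma0 dgamma]]].
  have [_ dgamma0 _] := Mgamma 0 ltac:(by rewrite normr0).
  have d1 : is_derive (0 : R) 1 gamma v.
    by split => //; rewrite -derive1E.
  have fL0 : frechet_at f (gamma 0) (L x) by rewrite gamma0.
  have d2 := frechet_at_chain Llin LC fL0 d1.
  have [_ <-] := d2; have [_ <-] := d1.
  apply: near_eq_derive.
  apply/nbhs_normP; exists e => // t /=; rewrite sub0r normrN => te.
  by apply: truncation_id; have [] := Mgamma t te.
set n := g - p; set w := L x n.
have nw : ip n w = 0 by apply: gp; exact: tangentL.
have Un0 : U (x + 0 *: n) by rewrite scale0r addr0.
have := d_line n 0 Un0.
rewrite scale0r addr0 -/w => /is_derive1P dn.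
(* Dividing [|x + s *: n - f (x + s *: n)| <= |s *: n|] by a small [s], here [r / 2], leaves an
   error at most the arbitrary [e]. *)
have nw_le : `|n - w| <= `|n|.
  apply/ler_addgt0Pr => e e0.
  have : \forall h \near (0 : R), U (x + h *: n) /\
     `|f (x + (0 + h) *: n) - f (x + 0 *: n) - h *: w| <= e * `|h|.
    exact: filterI (near_line n) (dn e e0).
  move=> /nbhs_normP[r/= r0 rP].
  have r2 : 0 < r / 2 by rewrite divr_gt0.
  have [Us] : U (x + (r / 2) *: n) /\ `|f (x + (0 + r / 2) *: n)
      - f (x + 0 *: n) - (r / 2) *: w| <= e * `|r / 2|.
    by apply: rP => /=; rewrite sub0r normrN gtr0_norm// ltr_pdivrMr//; lra.
  rewrite add0r scale0r addr0 fx.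
  have [_ /(_ x Mx)] := Ubest _ Us.
  rewrite -/f [x + _ - x]addrAC subrr add0r => fb fw.
  rewrite -(ler_pM2l r2) -[X in X * `|n - w|](gtr0_norm r2) -normrZ mulrDr.
  rewrite -[X in X * `|n|](gtr0_norm r2) -normrZ.
  have -> : (r / 2) *: (n - w) = (x + (r / 2) *: n - f (x + (r / 2) *: n)) +
      (f (x + (r / 2) *: n) - x - (r / 2) *: w).
    by rewrite !addrA subrK [x + _ - x]addrAC subrr add0r scalerBr.
  apply: le_trans (ler_normD _ _) _; apply: lerD => //.
  by move: fw; rewrite (gtr0_norm r2) (mulrC e).
(* By orthogonality [|n - w| ^+ 2] is [|n| ^+ 2 + |w| ^+ 2], which [nw_le] bounds by [|n| ^+ 2]. *)
have w0 : w = 0.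
  have := ler_pM (normr_ge0 _) (normr_ge0 _) nw_le nw_le.
  rewrite -!expr2 (normB_sqr ipP) nw mulr0 subr0 gerDl => w2.
  by apply/eqP; rewrite -normr_eq0 -sqrf_eq0 eq_le w2 sqr_ge0.
by rewrite -[g](subrK p) -/n -[n]scale1r Llin -/w w0 scaler0 add0r L_tangent.
Qed.

(** * Comparison of one truncated step with one step of the projected flow *)

Lemma truncation_step_consistency (R : realType) (V : normedModType R)
    (ip : V -> V -> R) (ipP : is_inner_product ip) (M : set V) (x g p : V)
    (Phi S : R -> V) :
  smooth_truncation M -> M x -> tangent_space M x p ->
  (forall v, tangent_space M x v -> ip (g - p) v = 0) ->
  (fun dt : R => Phi dt - g) =O_ (0^'+) (fun dt : R => dt) ->
  (fun dt : R => S dt - (x + dt *: p)) =O_ (0^'+) (fun dt : R => dt ^+ 2) ->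
  (fun dt : R => `|truncation M (x + dt *: Phi dt) - S dt|)
    =O_ (0^'+) (fun dt : R => dt ^+ 2).
Proof.
move=> smoothM Mx xp gp /eqO_exP[K K0 PhiK] /eqO_exP[K' K'0 SK].
have [U [oU Ux Ubest /(frechet_smooth_C11 oU)[L UL]]] := smoothM _ Mx.
have LE : L x g = p.
  apply: (@truncation_derivative _ _ _ ipP M U) => //.
  by move=> u /Ubest; exact: truncation_best.
have [Llin [C C0 LC] fL Lx] := UL x Ux.
have [C2 C20] : exists2 C : R, 0 < C & \forall h \near (0 : V),
    `|truncation M (x + h) - truncation M x - L x h| <= C * `|h| ^+ 2.
  apply: (@frechet_second_order _ _ _ ipP U) => // y /UL[? [D _ ?] ? _].
  by split => //; exists D.
move=> /nbhs_normP[e/= e0 second_order].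
(* [B] bounds [|Phi dt|] once [dt <= 1]. *)
set B := `|g| + K.
have B0 : 0 < B by rewrite ltr_wpDl.
(* The three summands come from the Taylor remainder of the truncation, from its derivative applied
   to [Phi dt - g], and from the error of [S]. *)
apply/eqO_exP; exists (C2 * B ^+ 2 + C * K + K').
  by rewrite !addr_gt0// mulr_gt0// exprn_gt0.
near=> dt.
have dt0 : 0 < dt by near: dt; exact: nbhs_right_gt.
have dt1 : dt <= 1 by near: dt; exact: nbhs_right_le.
(* Keeps [dt *: Phi dt] in the ball where the Taylor bound holds. *)
have dte : dt < e / B by near: dt; apply: nbhs_right_lt; rewrite divr_gt0.
have : `|Phi dt - g| <= K * `|dt| by near: dt.
have : `|S dt - (x + dt *: p)| <= K' * `|dt ^+ 2| by near: dt.
rewrite (gtr0_norm dt0) !ger0_norm ?sqr_ge0// => Sdt Phidt.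
have PhiB : `|dt *: Phi dt| <= dt * B.
  rewrite normrZ gtr0_norm// ler_pM2l// -(subrK g (Phi dt)).
  rewrite (le_trans (ler_normD _ _))// /B addrC lerD2l (le_trans Phidt)//.
  by rewrite ler_piMr// ltW.
have step : `|truncation M (x + dt *: Phi dt) - truncation M x
    - L x (dt *: Phi dt)| <= C2 * `|dt *: Phi dt| ^+ 2.
  apply: second_order => /=; rewrite sub0r normrN (le_lt_trans PhiB)//.
  by rewrite -ltr_pdivlMr.
have L0 : L x 0 = 0.
  by have := Llin (-1) 0 0; rewrite scaler0 addr0 scaleN1r addNr.
have LPhi : L x (dt *: Phi dt) = dt *: L x (Phi dt - g) + dt *: p.
  by rewrite -LE -scalerDr -[L x (Phi dt - g)]scale1r -Llin scale1r subrK
    -[dt *: Phi dt]addr0 Llin L0 addr0.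
have -> : truncation M (x + dt *: Phi dt) - S dt =
    (truncation M (x + dt *: Phi dt) - truncation M x - L x (dt *: Phi dt))
    + dt *: L x (Phi dt - g) - (S dt - (x + dt *: p)).
  rewrite LPhi (truncation_id Mx).
  set a := dt *: L x _; set b := dt *: p; set y := truncation M _.
  have -> : y - x - (a + b) = y - (x + b) - a.
    by rewrite !opprD !addrA [LHS]addrAC.
  by rewrite subrK opprB addrA subrK.
rewrite (le_trans (ler_normB _ _))// mulrDl lerD//.
rewrite (le_trans (ler_normD _ _))// mulrDl lerD//.
- rewrite (le_trans step)// -mulrA ler_pM2l// -exprMn lerXn2r ?nnegrE//.
    by rewrite mulr_ge0// ltW.
  by rewrite mulrC.
- rewrite normrZ gtr0_norm// (le_trans (ler_wpM2l (ltW dt0) (LC _)))//.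
  rewrite expr2 -!mulrA mulrCA ler_pM2l//.
  by rewrite [leRHS]mulrCA ler_pM2l.
Unshelve. all: by end_near. Qed.

Unset Implicit Arguments.

Theorem lemma3p1 (R : realType) (d : nat) (a b : 'I_d -> R)
    (mu_ : 'I_d -> {finite_measure set R -> \bar R})
    (mu : {finite_measure set (d.-tuple R) -> \bar R})
    (r : nat -> nat)
    (G : LspaceType2 mu -> LspaceType2 mu)
    (Phi : (LspaceType2 mu -> LspaceType2 mu) -> LspaceType2 mu -> R ->
           LspaceType2 mu)
    (S : R -> LspaceType2 mu -> LspaceType2 mu)
    (ur : LspaceType2 mu) (Pur : LspaceType2 mu -> LspaceType2 mu)
    (d_gt0 : (0 < d)%N)
    (ab : forall i, a i <= b i)
    (mu_support : forall i, is_carried_by (mu_ i) (a i) (b i))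
    (mu_product : is_product_measure mu_ mu)
    (r_gt0 : forall i, (i <= d)%N -> (0 < r i)%N)
    (r_first : r 0%N = 1%N) (r_last : r d = 1%N)
    (truncation_smooth : smooth_truncation (ftt_manifold mu_ mu r))
    (ur_in : ftt_manifold mu_ mu r ur)
    (Pur_proj : is_orthogonal_projection
                  (tangent_space (ftt_manifold mu_ mu r) ur) Pur)
    (Phi_first_order : (fun dt : R => Phi G ur dt - G ur) =O_ (0^'+)
                       (fun dt : R => dt))
    (S_first_order : (fun dt : R => S dt ur - (ur + dt *: Pur (G ur)))
                     =O_ (0^'+) (fun dt : R => dt ^+ 2)) :
  (fun dt : R => `|truncation (ftt_manifold mu_ mu r)
                     (ur + dt *: Phi G ur dt) - S dt ur|)
  =O_ (0^'+) (fun dt : R => dt ^+ 2).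
Proof.
(* Tangency of [Pur (G ur)] and normality of the residual are the conditions imposed on [p]. *)
have [Ptangent Pnormal] := Pur_proj (G ur).
exact: (@truncation_step_consistency _ _ _ (L2_innerP mu) _ ur (G ur)
  (Pur (G ur)) (Phi G ur) (S^~ ur)).
Qed.
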